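(* The threshold bias $t(n,\mathcal{C})$ of the monotone $b$-biased Oriented-cycle game on $K_n$ satisfies $t(n,\mathcal{C}) \leq 0.7841\,n + O(1)$; that is, there is an absolute constant $K$ such that $t(n,\mathcal{C}) \le 0.7841\,n + K$ for all positive integers $n$.
   Context: The (monotone) $b$-biased Oriented-cycle game on the complete graph $K_n$, for a positive integer $b$: two players, OMaker and OBreaker, alternately direct previously undirected edges of $K_n$ until all edges have been directed. Initially no edge is directed. In each round OMaker moves first and directs exactly one previously undirected edge (choosing one of its two orientations); then OBreaker directs at least one and at most $b$ previously undirected edges (choosing their orientations). The game ends as soon as all edges are directed. OMaker wins if and only if the resulting tournament contains a directed cycle; otherwise OBreaker wins. Since OBreaker may direct fewer than $b$ edges, the game is monotone in $b$: if OBreaker has a winning strategy for bias $b$ then also for every larger bias. The threshold bias $t(n,\mathcal{C})$, where $\mathcal{C}$ is the property of containing a directed cycle, is the integer such that OMaker has a winning strategy in the $b$-biased Oriented-cycle game on $K_n$ if and only if $b\le t(n,\mathcal{C})$ (i.e. the largest $b$ for which OMaker has a winning strategy, taken to be $0$ if there is no such positive integer $b$). *)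

(* Defs.v *)
From mathcomp Require Import all_boot all_order all_algebra.
From mathcomp Require Import boolp reals.

Set Implicit Arguments.
Unset Strict Implicit.
Unset Printing Implicit Defensive.

(* [(x, y) \in D] means that the edge [xy] of K_n has been directed from [x]
   to [y]. *)
Definition arc (n : nat) : Type := ('I_n * 'I_n)%type.
Definition board (n : nat) : Type := {set 'I_n * 'I_n}.

Definition rev_arc (n : nat) (a : arc n) : arc n := (a.2, a.1).

(* [a] is an orientation of an edge of K_n that is undirected in [D]. *)
Definition free (n : nat) (D : board n) (a : arc n) : bool :=
  [&& a.1 != a.2, a \notin D & rev_arc a \notin D].

Definition all_directed (n : nat) (D : board n) : Prop :=
  forall a : arc n, ~~ free D a.

Definition has_dicycle (n : nat) (D : board n) : Prop :=
  exists c : seq 'I_n, c != [::] /\ ucycle (fun x y => (x, y) \in D) c.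

(* In one turn OBreaker directs the edges underlying [A], each of them in one
   direction only. *)
Definition obreaker_move (n b : nat) (D A : board n) : Prop :=
  (forall a : arc n, a \in A -> free D a && (rev_arc a \notin A)) /\
  0 < #|A| <= b.

(* OMaker's next arc as a function of OBreaker's past moves, the most recent
   one first; these moves and the strategy determine OMaker's past moves. *)
Definition strategy (n : nat) : Type := seq (board n) -> arc n.

Fixpoint board_after (n : nat) (s : strategy n) (h : seq (board n)) : board n :=
  if h is A :: h' then (s h' |: board_after s h') :|: A else set0.

Fixpoint legal_history (n b : nat) (s : strategy n) (h : seq (board n)) : Prop :=
  if h is A :: h' then
    legal_history b s h' /\ obreaker_move b (s h' |: board_after s h') A
  else True.

(* The game may end after a move of either player. *)
Definition winning (n b : nat) (s : strategy n) : Prop :=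
  forall h : seq (board n), legal_history b s h ->
    let D := board_after s h in
    (all_directed D -> has_dicycle D) /\
    (~ all_directed D ->
       free D (s h) /\ (all_directed (s h |: D) -> has_dicycle (s h |: D))).

Definition omaker_wins (n b : nat) : Prop :=
  exists s : strategy n, winning b s.

Lemma legal_history_mono (n b b' : nat) (s : strategy n) (h : seq (board n)) :
  b <= b' -> legal_history b s h -> legal_history b' s h.
Proof.
move=> bb'; elim: h => [|A h IH] //= [/IH Hh [HA /andP[A0 Ab]]].
by split=> //; split=> //; rewrite A0 (leq_trans Ab).
Qed.

Lemma omaker_wins_anti (n b b' : nat) :
  b <= b' -> omaker_wins n b' -> omaker_wins n b.
Proof.
by move=> bb' [s Hs]; exists s => h /(legal_history_mono bb'); exact: Hs.
Qed.

Lemma transitive_acyclic (n : nat) (D : board n) (r : rel 'I_n) :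
  irreflexive r -> transitive r ->
  (forall x y, (x, y) \in D -> r x y) -> ~ has_dicycle D.
Proof.
move=> rI rT Dr [[|x p] [// _ /andP[/= Hp _]]].
have : path r x (rcons p x) by apply: sub_path Hp => u v; apply: Dr.
by move/(order_path_min rT)/allP/(_ x); rewrite mem_rcons inE eqxx rI => /(_ isT).
Qed.

Lemma omaker_wins_bound (n b : nat) : omaker_wins n b -> b <= n * n.
Proof.
move=> [s Hs]; rewrite leqNgt; apply/negP => nb.
have /= [H0 H1] := Hs [::] I.
have nd0 : ~ all_directed (set0 : board n).
  move=> /H0; apply: (@transitive_acyclic _ _ (fun x y => x < y)).
  - by move=> x; rewrite /= ltnn.
  - by move=> y x z; apply: ltn_trans.
  - by move=> x y; rewrite inE.
have [/and3P[ne _ _] H2] := H1 nd0.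
set a := s [::] in ne H2.
pose r : rel 'I_n := fun x y => if a.1 < a.2 then x < y else y < x.
have rI : irreflexive r by move=> x; rewrite /r; case: ifP; rewrite ltnn.
have rT : transitive r.
  move=> y x z; rewrite /r; case: ifP => _; first exact: ltn_trans.
  by move=> xy yz; apply: ltn_trans xy.
have rtot x y : x != y -> r x y || r y x.
  by rewrite /r -val_eqE neq_ltn; case: ifP => _ //; rewrite orbC.
have ra : r a.1 a.2.
  rewrite /r; case: ifP => // /negbT; rewrite -leqNgt leq_eqVlt => /orP[|//].
  by rewrite val_eqE eq_sym (negPf ne).
pose T : board n := [set e | r e.1 e.2].
have aT : a \in T by rewrite inE.
have Tend : all_directed T.
  move=> e; apply/negP => /and3P[ee]; rewrite !inE /= => /negPf re /negPf re'.
  by have := rtot _ _ ee; rewrite re re'.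
have Tac : ~ has_dicycle T.
  by apply: (transitive_acyclic rI rT) => x y; rewrite inE.
have [A0|A0] := posnP #|T :\ a|.
  have TE : a |: set0 = T.
    by rewrite -(setD1K aT); congr (_ |: _); apply/esym/cards0_eq.
  by rewrite TE in H2; apply/Tac/H2.
have leg : legal_history b s [:: T :\ a].
  split=> //; split; last first.
    rewrite A0 /=; apply: leq_trans (max_card _) _.
    by rewrite card_prod card_ord ltnW.
  move=> e; rewrite !inE => /andP[ea re].
  have re' : r e.2 e.1 = false.
    by apply/negP => re'; have := rT _ _ _ re re'; rewrite rI.
  rewrite /free !inE /= re' andbF andbT !orbF ea /=; apply/andP; split.
    by apply/eqP => E; move: re; rewrite E rI.
  apply/eqP => E; have [E1 E2] : a.1 = e.2 /\ a.2 = e.1 by rewrite /a -E.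
  by move: ra; rewrite E1 E2 re'.
have /= [+ _] := Hs _ leg.
rewrite -/a setU0 setD1K // => H; exact/Tac/H.
Qed.

Lemma threshold_exists (n : nat) :
  exists b : nat, (b == 0) || `[< omaker_wins n b >].
Proof. by exists 0. Qed.

Lemma threshold_bounded (n b : nat) :
  (b == 0) || `[< omaker_wins n b >] -> b <= n * n.
Proof. by case/orP => [/eqP -> //|/asboolP]; apply: omaker_wins_bound. Qed.

Definition threshold (n : nat) : nat :=
  ex_maxn (threshold_exists n) (@threshold_bounded n).

Lemma thresholdP (n b : nat) :
  0 < b -> omaker_wins n b <-> b <= threshold n.
Proof.
move=> b0; rewrite /threshold; case: ex_maxnP => t Ht tmax; split.
  by move=> Hb; apply: tmax; apply/orP; right; apply/asboolP.
move=> bt; case/orP: Ht => [/eqP t0|/asboolP]; last exact: omaker_wins_anti.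
by move: b0; rewrite lt0n -leqn0 -t0 bt.
Qed.

(* Main.v *)
Require Import Defs.
From mathcomp Require Import all_boot all_order all_algebra.
From mathcomp Require Import boolp reals.
From mathcomp Require Import zify lra.

Set Implicit Arguments.
Unset Strict Implicit.
Unset Printing Implicit Defensive.

Import Order.TTheory GRing.Theory Num.Theory.
Local Open Scope ring_scope.

(** OBreaker keeps the board an interval order: every vertex [x] carries an
    interval [lft x, rgt x], and [xy] is directed from [x] to [y] exactly when
    the interval of [x] ends before that of [y] starts.  Such a board is
    acyclic, an edge is undirected iff its two intervals meet, and shrinking
    intervals only directs new edges.  When OMaker directs [v -> w], OBreaker
    chooses a point [c] common to both intervals, makes [v] end and [w] start
    there, and directs what this forces: edges from [v] to the intervals
    starting after [c], and edges to [w] from the intervals ending before [c].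
    So the number of intervals missing [c], the price of [c], bounds the cost.

    A marked point separates the sources, whose intervals end before it, from
    the sinks, whose intervals start after it; all source-sink edges are
    directed.  Say there are [a] sources and [b] sinks.  Once every vertex is a
    source or a sink, OMaker plays inside one of the two classes, and a reply
    costs at most the size of that class ([split_small_reply]): OBreaker is
    safe if both sizes are below the bias.

    Until then OBreaker must keep cheap points available on both sides of the
    mark.  A cut at [c] duplicates [c], and raises the price of no surviving
    point by more than one ([left_cheap_cut], [right_cheap_cut]).  Hence, if
    [t] rounds have been played and [m] vertices, about half on each side, have
    been made sources or sinks beyond the one per round that accompanies each
    reply, then [a + b = t + m] and every OMaker arc can be answered at a price
    of about [t + m / 2] ([balanced_reply]).  Making one further vertex a source
    costs [b] edges, making one a sink costs [a], and two consecutive additions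
    cost about [t + m] ([balanced_add], [balanced_add2]).

    If [m] reaches [0.434 n], replies alone suffice from then on: as long as
    some vertex is neither source nor sink, [t + m < n], so the price stays
    below [n - m / 2 = 0.783 n].  It remains to reach this value early, while
    a bias of [0.784 n] still pays for additions on top of the replies.  In the
    first [0.03 n] rounds OBreaker adds greedily; as the edges so directed are
    counted by [a * b], this brings [m] to [0.21 n].  Then two additions per
    round are affordable up to round [0.11 n], and one per round up to round
    [0.174 n] ([schedule_step]). *)

(** * Boards and safe replies *)

Lemma has_dicycleS (n : nat) (D E : board n) :
  D \subset E -> has_dicycle D -> has_dicycle E.
Proof.
move=> /subsetP DE [c [c0 /andP[cD cu]]]; exists c; split=> //.
apply/andP; split=> //; case: c c0 cD cu => // x p _ /= cD _.
by apply: sub_path cD => u v; apply: DE.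
Qed.

Lemma acyclic_asym (n : nat) (D : board n) (a : Defs.arc n) :
  ~ has_dicycle D -> a \in D -> (a.1 != a.2) && (rev_arc a \notin D).
Proof.
case: a => x y Dac xyD /=.
have xy : x != y.
  apply/eqP => xy; apply: Dac; exists [:: x]; split=> //.
  by apply/andP; rewrite /= {2}xy xyD.
rewrite xy; apply/negP => yxD; apply: Dac; exists [:: x; y]; split=> //.
by apply/andP; rewrite /= xyD [(y, x) \in D]yxD inE xy.
Qed.

Lemma obreaker_move_diff (n b : nat) (D E : board n) :
  ~ has_dicycle E -> D \proper E -> (#|E| <= #|D| + b)%N ->
  obreaker_move b D (E :\: D).
Proof.
move=> Eac DE cE; have sDE := proper_sub DE; split=> [a|].
  rewrite inE => /andP[aD aE]; have /andP[a12 raE] := acyclic_asym Eac aE.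
  rewrite /Defs.free a12 aD inE (negPf raE) andbF andbT /=.
  by apply: contra raE => /(subsetP sDE).
rewrite cardsD (setIidPr sDE); have := proper_card DE; lia.
Qed.

(** A family of acyclic boards that OBreaker can restore after every OMaker arc
    defeats every OMaker strategy.  The count includes OMaker's arc, which leaves
    [b - 1] arcs for the reply; the spare arc matters when OMaker's own move
    already restores the family and OBreaker, who may not pass, has to answer an
    arc that he plays himself. *)
Lemma obreaker_wins (n b : nat) (safe : board n -> Prop) :
  safe set0 -> (forall D, safe D -> ~ has_dicycle D) ->
  (forall D a, safe D -> Defs.free D a ->
     exists E, [/\ safe E, a |: D \subset E & #|E| <= #|D| + b]%N) ->
  ~ omaker_wins n b.
Proof.
move=> safe0 safe_ac reply [s Hs].
suff : forall k h, legal_history b s h -> safe (board_after s h) ->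
    (#|~: board_after s h| < k)%N -> False.
  by move=> /(_ _ [::] I safe0 (leqnn _)).
elim=> // k IH h Hh sD; rewrite ltnS => Dk.
have [Dend Dgo] := Hs h Hh.
have /Dgo [fa aend] : ~ all_directed (board_after s h) by move/Dend/(safe_ac _ sD).
set D := board_after s h in sD Dk fa aend; set a := s h in fa aend.
have [E [sE aDE cE]] := reply D a sD fa.
have nend : ~ all_directed (a |: D).
  by move=> /aend /(has_dicycleS aDE); apply: safe_ac.
have cD1 : #|a |: D| = #|D|.+1 by case/and3P: fa => _ aD _; rewrite cardsU1 aD.
(* If nothing is left to reply, OBreaker plays some free [a'] himself and
   replies to it in the same turn. *)
have [E' [sE' aDE' cE']] : exists E', [/\ safe E', a |: D \proper E' &
    #|E'| <= #|a |: D| + b]%N.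
  have [EaD|neq] := eqVneq (a |: D) E; last first.
    by exists E; rewrite properEneq neq aDE cD1; split=> //; lia.
  rewrite -EaD in sE.
  have [a' fa'] : exists a', Defs.free (a |: D) a'.
    by apply: contrapT => nex; apply: nend => a'; apply/negP => fa'; apply: nex; exists a'.
  have [E' [sE' aDE' cE']] := reply _ a' sE fa'.
  exists E'; split=> //; case/and3P: fa' => _ a'D _.
  rewrite properE (subset_trans _ aDE') ?subsetU1 //; apply/negP.
  by move=> /subsetP/(_ a'); rewrite (negPf a'D) (subsetP aDE') ?setU11 // => /(_ isT).
have E'D : board_after s (E' :\: (a |: D) :: h) = E'.
  by rewrite /= setUC setDE setUIl (setUC (~: _)) setUCr setIT; apply/setUidPl/proper_sub.
apply: (IH (E' :\: (a |: D) :: h)).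
- by split=> //; apply: obreaker_move_diff => //; apply: safe_ac.
- by rewrite E'D.
rewrite E'D; apply: leq_trans Dk; apply: proper_card; rewrite properE.
have /properP[sub [x xE xD]] := aDE'.
rewrite setCS (subset_trans _ sub) ?subsetU1 //=.
apply/negP => /subsetP/(_ x); rewrite in_setC [x \in ~: E']in_setC xE.
by move: xD; rewrite in_setU1 negb_or => /andP[_ ->] /(_ isT).
Qed.

(** * Interval orders and their cuts *)
Record layout (n : nat) := Layout {
  lft : 'I_n -> int;
  rgt : 'I_n -> int;
  mark : int;
  lft_le_rgt : forall x, lft x <= rgt x }.

Definition arcs (n : nat) (L : layout n) : board n :=
  [set a : Defs.arc n | rgt L a.1 < lft L a.2].

Definition early (n : nat) (L : layout n) (c : int) : {set 'I_n} :=
  [set x | rgt L x < c].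
Definition late (n : nat) (L : layout n) (c : int) : {set 'I_n} :=
  [set x | c < lft L x].

(** The number of intervals missing [c]: it bounds what OBreaker pays for
    answering an arc between two vertices whose intervals contain [c]. *)
Definition price (n : nat) (L : layout n) (c : int) : nat :=
  (#|early L c| + #|late L c|)%N.

Definition sources (n : nat) (L : layout n) := early L (mark L).
Definition sinks (n : nat) (L : layout n) := late L (mark L).

(** The two ends of the intersection of two intervals are a left end and a right
    end.  Asking for a cheap point between any left end and any later right end
    thus covers every window that OMaker can offer; unlike a condition on pairs
    of vertices it also survives cuts. *)
Definition left_cheap (n : nat) (L : layout n) (K : nat) : Prop :=
  forall x y, lft L x <= mark L -> lft L x <= rgt L y ->
  exists c, [/\ lft L x <= c, c <= rgt L y, c <= mark L & (price L c <= K)%N].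
Definition right_cheap (n : nat) (L : layout n) (K : nat) : Prop :=
  forall x y, mark L <= rgt L y -> lft L x <= rgt L y ->
  exists c, [/\ lft L x <= c, c <= rgt L y, mark L <= c & (price L c <= K)%N].

Lemma arcs_acyclic (n : nat) (L : layout n) : ~ has_dicycle (arcs L).
Proof.
apply: (@transitive_acyclic n _ (fun x y => rgt L x < lft L y)).
- by move=> x; apply/negbTE; rewrite -leNgt lft_le_rgt.
- by move=> y x z xy yz; apply: lt_trans xy (le_lt_trans (lft_le_rgt L y) yz).
- by move=> x y; rewrite inE.
Qed.

(** Negating the coordinates reverses all arcs and exchanges sources with sinks,
    so that only moves on the left of the mark have to be studied. *)
Lemma flip_subproof (n : nat) (L : layout n) (x : 'I_n) :
  - rgt L x <= - lft L x.
Proof. by rewrite lerN2 lft_le_rgt. Qed.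

Definition flip (n : nat) (L : layout n) : layout n :=
  Layout (- mark L) (flip_subproof L).

Lemma early_flip (n : nat) (L : layout n) (c : int) :
  early (flip L) c = late L (- c).
Proof. by apply/setP => x; rewrite !inE /= ltrNl. Qed.

Lemma late_flip (n : nat) (L : layout n) (c : int) :
  late (flip L) c = early L (- c).
Proof. by apply/setP => x; rewrite !inE /= ltrNr. Qed.

Lemma price_flip (n : nat) (L : layout n) (c : int) :
  price (flip L) c = price L (- c).
Proof. by rewrite /price early_flip late_flip addnC. Qed.

Lemma left_cheap_flip (n : nat) (L : layout n) (K : nat) :
  right_cheap L K -> left_cheap (flip L) K.
Proof.
move=> H x y /= h1 h2; have [|| c [? ? ? ?]] := H y x; try lia.
by exists (- c); rewrite price_flip opprK; split=> //=; lia.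
Qed.

Lemma right_cheap_flip (n : nat) (L : layout n) (K : nat) :
  left_cheap L K -> right_cheap (flip L) K.
Proof.
move=> H x y /= h1 h2; have [|| c [? ? ? ?]] := H y x; try lia.
by exists (- c); rewrite price_flip opprK; split=> //=; lia.
Qed.

(** The point [c] is doubled into [c] and [c + 1] by shifting everything right
    of it; [v] is made to end at the first copy and the members of [W] to start
    at the second one.  [W] is the singleton of the head of OMaker's arc, or empty
    when [v] is only being turned into a source.  The mark moves along with the
    right copy, so that cuts at or left of the mark turn [v] into a source. *)
Definition cuttable (n : nat) (L : layout n) (v : 'I_n) (W : {set 'I_n})
    (c : int) : Prop :=
  [/\ v \notin W, lft L v <= c <= rgt L v &
      forall w, w \in W -> lft L w <= c <= rgt L w].

Lemma cut_subproof (n : nat) (L : layout n) v W c (cvW : cuttable L v W c) x :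
  (if x \in W then c + 1 else if c < lft L x then lft L x + 1 else lft L x) <=
  (if x == v then c else if c <= rgt L x then rgt L x + 1 else rgt L x).
Proof.
have [vW hv hW] := cvW; have := lft_le_rgt L x.
have [xW|xW] := boolP (x \in W); last first.
  by case: eqP => [->|_]; repeat case: ifP; lia.
by have := hW _ xW; case: eqP => [xv|_]; [rewrite -xv xW in vW | case: ifP; lia].
Qed.

Definition cut (n : nat) (L : layout n) v W c (cvW : cuttable L v W c) :
  layout n := Layout (mark L + 1) (cut_subproof cvW).

Lemma mem_arcs_cut (n : nat) (L : layout n) v W c (cvW : cuttable L v W c) x y :
  ((x, y) \in arcs (cut cvW)) =
  [|| (x, y) \in arcs L, (x == v) && ((y \in W) || (c < lft L y)) |
      (y \in W) && (rgt L x < c)].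
Proof.
have [vW hv hW] := cvW; rewrite !inE /=; have [yW|yW] := boolP (y \in W).
  have := hW _ yW; case: (eqVneq x v) => [->|_] /=; first lia.
  by case: ifP; lia.
case: (eqVneq x v) => [->|_] /=; first by case: ifP; lia.
by repeat case: ifP; lia.
Qed.

Lemma early_cut_le (n : nat) (L : layout n) v W c (cvW : cuttable L v W c) d :
  d <= c -> early (cut cvW) d \subset early L d.
Proof.
by move=> dc; apply/subsetP => x; rewrite !inE /=; repeat case: ifP; lia.
Qed.

Lemma late_cut_le (n : nat) (L : layout n) v W c (cvW : cuttable L v W c) d :
  d <= c -> late (cut cvW) d \subset W :|: late L d.
Proof.
by move=> dc; apply/subsetP => x; rewrite !inE /=; repeat case: ifP => //; lia.
Qed.

Lemma early_cut_ge (n : nat) (L : layout n) v W c (cvW : cuttable L v W c) d :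
  c <= d -> early (cut cvW) (d + 1) = v |: early L d.
Proof.
move=> cd; apply/setP => x; rewrite !inE /=; case: eqVneq => //= _; first lia.
by case: ifP; lia.
Qed.

Lemma late_cut_ge (n : nat) (L : layout n) v W c (cvW : cuttable L v W c) d :
  c <= d -> late (cut cvW) (d + 1) = late L d.
Proof.
have [_ _ hW] := cvW; move=> cd; apply/setP => x; rewrite !inE /=.
by case: ifP => [/hW|_]; [lia|case: ifP; lia].
Qed.

(** A point up to the first copy of [c] can newly miss only the intervals of [W],
    and a point from the second copy on only that of [v]: the two effects of a
    cut never add up. *)
Lemma price_cut_le (n : nat) (L : layout n) v W c (cvW : cuttable L v W c) d :
  d <= c -> (price (cut cvW) d <= price L d + #|W|)%N.
Proof.
move=> dc; rewrite /price -addnA [(_ + #|W|)%N]addnC leq_add //.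
  exact/subset_leq_card/early_cut_le.
apply: leq_trans (subset_leq_card (late_cut_le cvW dc)) _.
by rewrite cardsU leq_subr.
Qed.

Lemma price_cut_ge (n : nat) (L : layout n) v W c (cvW : cuttable L v W c) d :
  c <= d ->
  price (cut cvW) (d + 1) = ((v \notin early L d) + price L d)%N.
Proof.
by move=> cd; rewrite /price early_cut_ge // late_cut_ge // cardsU1 addnA.
Qed.

(** Right of the mark the only change is that [v] now ends earlier, which is no
    change at all if [v] was a source already. *)
Lemma right_cheap_cut (n : nat) (L : layout n) v W c
    (cvW : cuttable L v W c) K :
  c <= mark L -> right_cheap L K ->
  right_cheap (cut cvW) ((v \notin sources L) + K).
Proof.
move=> cM NK x y; have [_ hv hW] := cvW => /= h1 h2.
have yv : y != v by apply/eqP => yv; move: h1; rewrite yv eqxx; lia.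
rewrite (negPf yv) in h1 h2 *.
have h1' : mark L <= rgt L y by move: h1; case: ifP; lia.
have h2' : lft L x <= rgt L y.
  by move: h2; case: ifP => [/hW|_]; repeat case: ifP; lia.
have [d [xd dy Md wd]] := NK x y h1' h2'.
exists (d + 1); split; first (by case: ifP => [_|_]; [lia|case: ifP; lia]).
- by case: ifP; lia.
- lia.
rewrite price_cut_ge ?(le_trans cM) // leq_add //.
by rewrite /sources !inE -!leNgt; case: (leP d) => // h; rewrite (le_trans Md).
Qed.

(** A window that loses its cheap point [d] was shortened by the cut, hence now
    ends at the first copy of [c] or starts at the second one; that copy is a
    substitute if [c] was cheap.  If [c] is the mark and [W] is empty, no [d] is
    ever lost, and no price on the left grows. *)
Lemma left_cheap_cut (n : nat) (L : layout n) v W c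
    (cvW : cuttable L v W c) K e :
  c <= mark L -> left_cheap L K -> (#|W| <= e)%N ->
  (0 < e)%N && (price L c <= K)%N \/ c = mark L /\ W = set0 ->
  left_cheap (cut cvW) (e + K).
Proof.
move=> cM NK We good x y; have [vW hv hW] := cvW => /= h1 h2.
have h1' : lft L x <= mark L.
  by move: h1; case: ifP => [/hW|_]; [lia|case: ifP; lia].
have h2' : lft L x <= rgt L y.
  move: h2; case: ifP => [/hW|_]; case: eqP => [->|_]; repeat case: ifP; lia.
have [d [xd dy dM wd]] := NK x y h1' h2'.
have at_c : (price L c <= K)%N -> (price (cut cvW) c <= e + K)%N.
  by move=> wc; apply: leq_trans (price_cut_le cvW (lexx c)) _; lia.
have after d' : (0 < e)%N -> c <= d' -> (price L d' <= K)%N ->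
    (price (cut cvW) (d' + 1) <= e + K)%N.
  by move=> e0 cd wd'; rewrite price_cut_ge // leq_add //; case: (_ \notin _).
have [xW|xW] := boolP (x \in W).
  have /andP[e0 wc] : (0 < e)%N && (price L c <= K)%N.
    by case: good => // -[_ W0]; rewrite W0 inE in xW.
  by exists (c + 1); split; rewrite ?after //; move: h2; rewrite xW; lia.
rewrite (negPf xW) in h1 h2.
have [dc|cd] := leP d c.
  exists d; split; rewrite ?(leq_trans (price_cut_le cvW dc)) //; try lia.
  - by case: ifP; lia.
  - by case: eqP => // _; case: ifP; lia.
have /andP[e0 wc] : (0 < e)%N && (price L c <= K)%N.
  by case: good => // -[cE _]; move: cd; rewrite cE ltNge dM.
have [yv|yv] := eqVneq y v.
  exists c; split; rewrite ?at_c //; try lia.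
  by move: h2; rewrite yv eqxx.
exists (d + 1); split; rewrite ?after ?(ltW cd) //; try lia; by case: ifP; lia.
Qed.


(** * Replies that keep cheap points available *)

Lemma card_arcs_cut (n : nat) (L : layout n) v W c (cvW : cuttable L v W c) :
  (#|arcs (cut cvW)| <= #|arcs L| + (#|W| + #|late L c :\: late L (rgt L v)|
                        + #|W| * #|early L c|))%N.
Proof.
pose N := W :|: late L c :\: late L (rgt L v).
have sub : arcs (cut cvW) \subset
    arcs L :|: ((pair v @: N) :|: setX (early L c) W).
  apply/subsetP => -[x y]; rewrite mem_arcs_cut !in_setU in_setX.
  case/or3P => [-> //|/andP[/eqP-> yN]|/andP[yW xc]]; last first.
    by rewrite [x \in early _ _]inE xc yW !orbT.
  have [vy|vy] := boolP ((v, y) \in arcs L) => //=.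
  apply/orP; left; apply: imset_f; rewrite !inE; case/orP: yN => [->//|cy].
  by move: vy; rewrite inE /= => ->; rewrite cy orbT.
apply: leq_trans (subset_leq_card sub) _.
apply: leq_trans (leq_card_setU _ _) _; rewrite leq_add2l.
apply: leq_trans (leq_card_setU _ _) _; rewrite cardsX mulnC leq_add2r.
by apply: leq_trans (leq_imset_card _ _) (leq_card_setU _ _).
Qed.

Definition extends (n : nat) (L L' : layout n) (k : nat) : Prop :=
  arcs L \subset arcs L' /\ (#|arcs L'| <= #|arcs L| + k)%N.

Lemma extends_refl (n : nat) (L : layout n) k : extends L L k.
Proof. by split=> //; apply: leq_addr. Qed.

Lemma extends_trans (n : nat) (L1 L2 L3 : layout n) k1 k2 k :
  extends L1 L2 k1 -> extends L2 L3 k2 -> (k1 + k2 <= k)%N -> extends L1 L3 k.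
Proof.
move=> [s12 c12] [s23 c23] k12; split; first exact: subset_trans s23.
by apply: leq_trans c23 _; lia.
Qed.

Lemma mem_arcs_flip (n : nat) (L : layout n) x y :
  ((x, y) \in arcs (flip L)) = ((y, x) \in arcs L).
Proof. by rewrite !inE /= ltrN2. Qed.

Lemma card_arcs_flip (n : nat) (L : layout n) : #|arcs (flip L)| = #|arcs L|.
Proof.
have inv : involutive (@rev_arc n) by case.
rewrite -(card_imset _ (inv_inj inv)); apply: eq_card => -[x y].
have -> : (x, y) = rev_arc (y, x) by [].
by rewrite (mem_imset _ _ (inv_inj inv)) mem_arcs_flip.
Qed.

Lemma extends_flip (n : nat) (L L' : layout n) k :
  extends (flip L) L' k -> extends L (flip L') k.
Proof.
move=> [sub card]; split; last by rewrite card_arcs_flip -(card_arcs_flip L).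
apply/subsetP => -[x y]; rewrite -mem_arcs_flip => /(subsetP sub).
by rewrite mem_arcs_flip.
Qed.

Definition complete (n : nat) (L : layout n) : Prop :=
  forall x, (x \in sources L) || (x \in sinks L).

(** [KA] and [KB] are the prices at which OBreaker can reply left and right of
    the mark.  Once the layout is complete no vertex is available to keep the
    sizes equal to [a] and [b]; then they are just upper bounds. *)
Definition structured (n : nat) (a b KA KB : nat) (L : layout n) : Prop :=
  [/\ left_cheap L KA, right_cheap L KB, (#|sources L| <= a)%N,
      (#|sinks L| <= b)%N &
      complete L \/ #|sources L| = a /\ #|sinks L| = b].

Lemma sources_flip (n : nat) (L : layout n) : sources (flip L) = sinks L.
Proof. by rewrite /sources early_flip opprK. Qed.

Lemma sinks_flip (n : nat) (L : layout n) : sinks (flip L) = sources L.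
Proof. by rewrite /sinks late_flip opprK. Qed.

Lemma complete_flip (n : nat) (L : layout n) : complete L -> complete (flip L).
Proof. by move=> cL x; rewrite sources_flip sinks_flip orbC. Qed.

Lemma complete_unflip (n : nat) (L : layout n) :
  complete (flip L) -> complete L.
Proof. by move=> cL x; have := cL x; rewrite sources_flip sinks_flip orbC. Qed.

Lemma structured_flip (n : nat) a b KA KB (L : layout n) :
  structured a b KA KB L -> structured b a KB KA (flip L).
Proof.
move=> [lN rN sa sb E]; rewrite /structured sources_flip sinks_flip.
split=> //; [exact: left_cheap_flip|exact: right_cheap_flip|].
by case: E => [/complete_flip|[]]; [left|right].
Qed.

Lemma structured_complete (n : nat) a b KA KB a' b' KA' KB' (L : layout n) :
  complete L -> structured a b KA KB L ->
  (a <= a')%N -> (b <= b')%N -> (KA <= KA')%N -> (KB <= KB')%N ->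
  structured a' b' KA' KB' L.
Proof.
move=> cL [lN rN sa sb _] aa bb KAA KBB; split; try by [left|apply: leq_trans; eauto].
- move=> x y h1 h2; have [c [? ? ? wc]] := lN x y h1 h2.
  by exists c; split=> //; apply: leq_trans wc _.
- move=> x y h1 h2; have [c [? ? ? wc]] := rN x y h1 h2.
  by exists c; split=> //; apply: leq_trans wc _.
Qed.

Lemma not_complete (n : nat) (L : layout n) :
  ~ complete L -> exists z, lft L z <= mark L <= rgt L z.
Proof.
move=> ncL; apply: contrapT => nex; apply: ncL => x; apply: contrapT => h.
by apply: nex; exists x; move: h; rewrite !inE => /negP; lia.
Qed.

(** A vertex that is neither source nor sink is cut at the mark, which costs at
    most one arc to each sink.  This adds an early vertex to points on the right
    of the mark and raises no price on its left. *)
Lemma add_source (n : nat) a b KA KB (L : layout n) :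
  structured a b KA KB L ->
  exists L', extends L L' b /\ structured a.+1 b KA KB.+1 L'.
Proof.
move=> sL; have [cL|/not_complete[z zM]] := pselect (complete L).
  by exists L; split; [apply: extends_refl|apply: structured_complete cL sL _ _ _ _].
have [lN rN sa sb E] := sL.
have cz : cuttable L z set0 (mark L) by split=> // [|w]; rewrite inE.
have zA : z \notin sources L by rewrite inE; lia.
have zncL : ~ complete L by move=> /(_ z); rewrite !inE; lia.
have {zncL} [Ea Eb] : #|sources L| = a /\ #|sinks L| = b by case: E.
have sA : sources (cut cz) = z |: sources L by rewrite /sources early_cut_ge.
have sB : sinks (cut cz) = sinks L by rewrite /sinks late_cut_ge.
exists (cut cz); split; first split.
- by apply/subsetP => -[x y]; rewrite mem_arcs_cut => ->.
- apply: leq_trans (card_arcs_cut cz) _; rewrite cards0 mul0n addn0 add0n.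
  by rewrite leq_add2l -Eb subset_leq_card // subsetDl.
have cA : #|sources (cut cz)| = a.+1 by rewrite sA cardsU1 zA Ea.
split; rewrite ?sB ?cA ?Eb //; last by right.
- by apply: (left_cheap_cut (e := 0%N)) => //; rewrite ?cards0 //; right.
- by have := right_cheap_cut (cvW := cz) (lexx _) rN; rewrite zA.
Qed.

Lemma add_sink (n : nat) a b KA KB (L : layout n) :
  structured a b KA KB L ->
  exists L', extends L L' a /\ structured a b.+1 KA.+1 KB L'.
Proof.
move=> /structured_flip /add_source [L' [eL' sL']].
by exists (flip L'); split; [apply: extends_flip|apply: structured_flip].
Qed.

(** The cut makes [v] a source.  If [v] is one already, its arcs to the [b] sinks
    are present, and the [b] arcs saved on the reply pay for another new
    source; so the sizes and prices evolve in the same way in both cases. *)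
Lemma reply_left (n : nat) a b KA KB (L : layout n) v w :
  ~ complete L -> structured a b KA KB L ->
  lft L v <= mark L -> lft L w <= mark L ->
  v != w -> lft L v <= rgt L w -> lft L w <= rgt L v ->
  exists L', [/\ extends L L' KA.+1, (v, w) \in arcs L' &
                 structured a.+1 b KA.+1 KB.+1 L'].
Proof.
move=> ncL [lN rN sa sb E] vM wM vw lvw lwv.
have [Ea Eb] : #|sources L| = a /\ #|sinks L| = b by case: E.
have [c [vc wc cv [cw cM wK]]] : exists c, [/\ lft L v <= c, lft L w <= c,
   c <= rgt L v & [/\ c <= rgt L w, c <= mark L & (price L c <= KA)%N]].
  pose x := if lft L v <= lft L w then w else v.
  pose y := if rgt L v <= rgt L w then v else w.
  have [||c [xc cy cM wK]] := lN x y; rewrite ?/x ?/y; first by case: ifP.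
    have := lft_le_rgt L v; have := lft_le_rgt L w.
    by repeat case: ifP; lia.
  by exists c; split; [..|split=> //]; move: xc cy; rewrite /x /y;
     repeat case: ifP; lia.
have cvw : cuttable L v [set w] c.
  by split; rewrite ?inE ?vc //= => u /set1P ->; rewrite wc.
have wlate : (#|late L c| <= KA)%N by apply: leq_trans wK; apply: leq_addl.
have sub : arcs L \subset arcs (cut cvw).
  by apply/subsetP => -[x y]; rewrite mem_arcs_cut => ->.
have vwin : (v, w) \in arcs (cut cvw).
  by rewrite mem_arcs_cut eqxx !inE eqxx /= orbT.
have sA : sources (cut cvw) = v |: sources L by rewrite /sources early_cut_ge.
have sB : sinks (cut cvw) = sinks L by rewrite /sinks late_cut_ge.
have lN' : left_cheap (cut cvw) KA.+1.
  by apply: (left_cheap_cut (e := 1%N)); rewrite ?cards1 // wK; left.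
have rN' := right_cheap_cut (cvW := cvw) cM rN.
have cost := card_arcs_cut cvw; rewrite cards1 mul1n in cost.
have [vA|vA] := boolP (v \in sources L); last first.
  rewrite vA /= in rN'; exists (cut cvw); split=> //.
    split=> //; apply: leq_trans cost _; rewrite leq_add2l -addnA add1n ltnS.
    by apply: leq_trans wK; rewrite addnC leq_add2l subset_leq_card // subsetDl.
  have cA : #|sources (cut cvw)| = a.+1 by rewrite sA cardsU1 vA Ea.
  by split; rewrite ?sB ?cA ?Eb //; right.
rewrite vA /= in rN'.
have sA' : sources (cut cvw) = sources L by rewrite sA; apply/setUidPr; rewrite sub1set.
have s' : structured a b KA.+1 KB (cut cvw).
  by split; rewrite ?sB ?sA' ?Ea ?Eb //; right.
have [L' [eL' sL']] := add_source s'.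
exists L'; split=> //; last by case: eL' => /subsetP + _; apply.
have bc : (b <= #|late L c|)%N.
  by rewrite -Eb subset_leq_card //; apply/subsetP => y; rewrite !inE; lia.
apply: extends_trans eL' (_ : KA.+1 - b + b <= KA.+1)%N; last by lia.
split=> //; apply: leq_trans cost _; rewrite leq_add2l.
have bD : (#|late L c :\: late L (rgt L v)| <= #|late L c| - b)%N.
  rewrite cardsD leq_sub2l // -Eb subset_leq_card //; apply/subsetP => y.
  by move: vA; rewrite !inE; lia.
by move: wK bc bD; rewrite /price; lia.
Qed.

Lemma reply_right (n : nat) a b KA KB (L : layout n) v w :
  ~ complete L -> structured a b KA KB L ->
  mark L <= rgt L v -> mark L <= rgt L w ->
  v != w -> lft L v <= rgt L w -> lft L w <= rgt L v ->
  exists L', [/\ extends L L' KB.+1, (v, w) \in arcs L' &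
                 structured a b.+1 KA.+1 KB.+1 L'].
Proof.
move=> ncL sL vM wM vw lvw lwv.
have [||||||L' [eL' vwL' sL']] :=
  @reply_left n b a KB KA (flip L) w v _ (structured_flip sL);
  rewrite /= ?lerN2 // 1?eq_sym //.
  by move/complete_unflip.
exists (flip L'); split; [exact: extends_flip|by rewrite mem_arcs_flip|].
exact: structured_flip.
Qed.

Lemma freeP (n : nat) (L : layout n) v w :
  Defs.free (arcs L) (v, w) ->
  [/\ v != w, lft L v <= rgt L w & lft L w <= rgt L v].
Proof. by case/and3P; rewrite !inE /= -!leNgt. Qed.

(** If [v] or [w] is a sink then neither is a source, because their intervals
    meet: the arc can be answered on one of the two sides of the mark. *)
Lemma reply (n : nat) a b KA KB (L : layout n) e :
  ~ complete L -> structured a b KA KB L -> Defs.free (arcs L) e ->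
  exists L', e \in arcs L' /\
    ((extends L L' KA.+1 /\ structured a.+1 b KA.+1 KB.+1 L') \/
     (extends L L' KB.+1 /\ structured a b.+1 KA.+1 KB.+1 L')).
Proof.
case: e => v w ncL sL /freeP [vw lvw lwv].
have := lft_le_rgt L v; have := lft_le_rgt L w => hw hv.
have [/andP[vM wM]|nM] := boolP ((lft L v <= mark L) && (lft L w <= mark L)).
  have [L' [? ? ?]] := reply_left ncL sL vM wM vw lvw lwv.
  by exists L'; split=> //; left.
have [||L' [? ? ?]] := reply_right ncL sL _ _ vw lvw lwv; try lia.
by exists L'; split=> //; right.
Qed.

(** * The complete phase *)

Definition split_small (n k : nat) (L : layout n) : Prop :=
  [/\ complete L, (#|sources L| < k)%N & (#|sinks L| < k)%N].

(** With the cut at the later of the two left ends, the new arcs besides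
    OMaker's involve different sources: arcs from [v] go to intervals starting
    after [c], arcs to [w] come from intervals ending before [c], and neither
    kind involves sinks. *)
Lemma split_small_reply_left (n k : nat) (L : layout n) v w :
  split_small k L -> rgt L v < mark L ->
  v != w -> lft L v <= rgt L w -> lft L w <= rgt L v ->
  exists L', [/\ extends L L' k, (v, w) \in arcs L' & split_small k L'].
Proof.
move=> [cL Ak Bk] vM vw lvw lwv.
have hv := lft_le_rgt L v; have hw := lft_le_rgt L w.
pose c := if lft L v <= lft L w then lft L w else lft L v.
have cvw : cuttable L v [set w] c.
  split; rewrite ?inE // /c; first by case: ifP; lia.
  by move=> u /set1P ->; case: ifP; lia.
have cM : c <= mark L by case: cvw => _; lia.
have sA : sources (cut cvw) = sources L.
  rewrite /sources early_cut_ge //; apply/setUidPr; rewrite sub1set inE; lia.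
have sB : sinks (cut cvw) = sinks L by rewrite /sinks late_cut_ge.
exists (cut cvw); split; first split.
- by apply/subsetP => -[x y]; rewrite mem_arcs_cut => ->.
- apply: leq_trans (card_arcs_cut cvw) _; rewrite leq_add2l cards1 mul1n -addnA.
  apply: leq_trans Ak; rewrite add1n ltnS -cardsUI.
  have -> : (late L c :\: late L (rgt L v)) :&: early L c = set0.
    by apply/setP => x; have := lft_le_rgt L x; rewrite !inE; lia.
  rewrite cards0 addn0 subset_leq_card //; apply/subsetP => x.
  by have := cL x; rewrite !inE; lia.
- by rewrite mem_arcs_cut eqxx !inE eqxx /= orbT.
split; rewrite ?sA ?sB // => x; rewrite sA sB; exact: cL.
Qed.

Lemma split_small_flip (n k : nat) (L : layout n) :
  split_small k L -> split_small k (flip L).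
Proof.
move=> [cL Ak Bk]; split; rewrite ?sources_flip ?sinks_flip //.
exact: complete_flip.
Qed.

Lemma split_small_reply (n k : nat) (L : layout n) e :
  split_small k L -> Defs.free (arcs L) e ->
  exists L', [/\ extends L L' k, e \in arcs L' & split_small k L'].
Proof.
case: e => v w sL /freeP [vw lvw lwv]; have [cL _ _] := sL.
have hv := lft_le_rgt L v; have hw := lft_le_rgt L w.
have [vM|vM] := ltP (rgt L v) (mark L).
  exact: split_small_reply_left.
have wB : mark L < lft L w.
  have := cL w; have := cL v; rewrite !inE; lia.
have [||||L' [eL' vwL' sL']] :=
  @split_small_reply_left n k (flip L) w v (split_small_flip sL);
  rewrite /= ?ltrN2 ?lerN2 // 1?eq_sym //.
exists (flip L'); split; [exact: extends_flip|by rewrite mem_arcs_flip|].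
exact: split_small_flip.
Qed.


(** * The schedule of additions *)

(** [t] counts rounds, each of which makes one vertex a source or a sink, and [m]
    counts the further additions, made alternately: source, sink, source, and
    so on.  OMaker decides which sides the [t] vertices go to, hence only the
    trivial bounds on [a] and [b] separately. *)
Definition balanced (n t m a b : nat) (L : layout n) : Prop :=
  [/\ structured a b (t + m./2) (t + uphalf m) L, (a + b = t + m)%N,
      (a <= t + uphalf m)%N & (b <= t + m./2)%N].

Lemma balanced_reply (n t m a b : nat) (L : layout n) e :
  ~ complete L -> balanced t m a b L -> Defs.free (arcs L) e ->
  exists L' a' b', [/\ extends L L' (t + uphalf m).+1, e \in arcs L',
    balanced t.+1 m a' b' L' & (a * b <= a' * b')%N].
Proof.
move=> ncL [sL ab aK bK] fe; have hm : (m./2 <= uphalf m)%N by lia.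
have [L' [eL' [[[sub card] sL']|[eLL' sL']]]] := reply ncL sL fe.
  exists L', a.+1, b; split=> //; last by rewrite leq_mul.
    by split=> //; apply: leq_trans card _; rewrite leq_add2l ltnS leq_add2l.
  by split=> //; lia.
by exists L', a, b.+1; split=> //; [split=> //; lia|rewrite leq_mul].
Qed.

Lemma balanced_add (n t m a b : nat) (L : layout n) :
  balanced t m a b L ->
  exists L', extends L L' (if odd m then a else b) /\
    balanced t m.+1 (a + ~~ odd m) (b + odd m) L'.
Proof.
move=> [sL ab aK bK].
have hh : (m.+1)./2 = (m./2 + odd m)%N by lia.
have hu : uphalf m.+1 = (uphalf m + ~~ odd m)%N by lia.
rewrite /balanced hh hu; case: (odd m) => /=; rewrite !addn0 !addn1 !addnS.
  by have [L' [eL' sL']] := add_sink sL; exists L'; split=> //; split=> //; lia.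
by have [L' [eL' sL']] := add_source sL; exists L'; split=> //; split=> //; lia.
Qed.

(** Two additions cost [a + b + 1] whatever the order, whereas a single one may
    cost as much as [t + uphalf m]. *)
Lemma balanced_add2 (n t m a b : nat) (L : layout n) :
  balanced t m a b L ->
  exists L', extends L L' (t + m).+1 /\ balanced t m.+2 a.+1 b.+1 L'.
Proof.
move=> bL; have [_ ab _ _] := bL.
have [L1 [e1 /balanced_add [L2 [e2 b2]]]] := balanced_add bL.
exists L2; split; first by apply: extends_trans e1 e2 _ => /=; case: (odd m) => /=; lia.
by move: b2 => /=; case: (odd m); rewrite /= ?addn0 ?addn1.
Qed.

(** Every addition costs at most the increase of [a * b], so OBreaker either makes
    all [d] additions or raises [a * b] by the whole budget [z], up to the price
    of the addition that no longer fits. *)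
Lemma balanced_greedy (n t d : nat) :
  forall (m a b z : nat) (L : layout n), balanced t m a b L ->
  exists m' a' b' L', [/\ balanced t m' a' b' L', extends L L' z,
    (m <= m' <= m + d)%N &
    m' = (m + d)%N \/ (a * b + z <= a' * b' + (t + uphalf m'))%N].
Proof.
elim: d => [|d IH] m a b z L bL.
  exists m, a, b, L; split=> //; first exact: extends_refl.
    by rewrite addn0 leqnn.
  by left; rewrite addn0.
have [_ _ aK bK] := bL.
have [cz|zc] := leqP (if odd m then a else b) z; last first.
  exists m, a, b, L; split=> //; [exact: extends_refl|by lia|right].
  by move: zc; case: ifP; lia.
have [L1 [e1 b1]] := balanced_add bL.
have [m' [a' [b' [L' [b2 e2 mm E]]]]] := IH _ _ _ (z - (if odd m then a else b))%N _ b1.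
exists m', a', b', L'; split=> //; [|by lia|].
  by apply: extends_trans e1 e2 _; lia.
case: E => [->|E]; [by left; lia|right; move: E cz].
by case: (odd m); rewrite /= ?addn0 ?addn1 ?mulSn ?mulnS; lia.
Qed.

(** With [k = n / 500] and bias [392 k + 600], the breakpoints are chosen so that
    the cost of a round, [t + m / 2] for the reply and then nothing, [t + m / 2]
    or [t + m] for zero, one or two additions, fits into the bias up to the end of
    each phase: [2 t + 3 m / 2] is [387.5 k] at [(t, m) = (55 k, 185 k)], and
    [2 t + m] is [391 k] at [(87 k, 217 k)]; finally [t + m < n] gives
    [t + m / 2 < 391.5 k + 500].  In the greedy phase the increase
    [257 k + 597] of [a * b] per round is the bias minus the reply and minus the
    addition that does not fit, which together are at most [135 k + 3]. *)
Definition on_schedule (k t m a b : nat) : Prop :=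
  [\/ [/\ t < 15 * k, m <= 105 * k &
          m = 105 * k \/ t * (257 * k + 597) <= a * b]%N,
      [/\ 15 * k <= t, t < 55 * k & m = 105 * k + 2 * (t - 15 * k)]%N,
      [/\ 55 * k <= t, t < 87 * k & m = 185 * k + (t - 55 * k)]%N |
      87 * k <= t /\ m = 217 * k]%N.

(** After [15 k] rounds of the greedy phase with fewer than [105 k] additions,
    [a + b <= 120 k] would leave [a * b] below what the greedy additions have
    directed. *)
Lemma head_start_bound (k P : nat) :
  (0 < k)%N -> (4 * P <= 120 * k * (120 * k))%N ->
  ~ (15 * k * (257 * k + 597) <= P)%N.
Proof. by move=> k0 h h'; nia. Qed.

Lemma schedule_step (n k t m a b : nat) (L : layout n) e :
  (n < 500 * k.+1)%N ->
  ~ complete L -> balanced t m a b L -> on_schedule k t m a b ->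
  Defs.free (arcs L) e ->
  exists L' t' m' a' b', [/\ extends L L' (392 * k + 600), e \in arcs L',
    balanced t' m' a' b' L', on_schedule k t' m' a' b' &
    (t' + uphalf m' < 392 * k + 600)%N].
Proof.
move=> nk ncL bL sch fe.
(* Sources and sinks are disjoint and miss some vertex. *)
have tmn : (t + m < n)%N.
  have [[_ _ _ _ E] <- _ _] := bL; have [//|[<- <-]] := E.
  have [z zM] := not_complete ncL; rewrite -cardsUI.
  have -> : sources L :&: sinks L = set0.
    by apply/setP => x; have := lft_le_rgt L x; rewrite !inE; lia.
  rewrite cards0 addn0 -[X in (_ < X)%N]card_ord -cardsT.
  apply: proper_card; rewrite properE subsetT; apply/subsetPn; exists z => //.
  by rewrite !inE; lia.
have [L1 [a1 [b1 [e1 eL1 bL1 ab1]]]] := balanced_reply ncL bL fe.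
case: sch => [[tk mk E]|[tk kt mE]|[tk kt mE]|[tk mE]].
- have z0 : (t + uphalf m < 392 * k + 600)%N by lia.
  have [m' [a' [b' [L' [bL' e2 mm' E']]]]] :=
    balanced_greedy (105 * k - m) (392 * k + 600 - (t + uphalf m).+1) bL1.
  exists L', t.+1, m', a', b'; split=> //.
  + by apply: extends_trans e1 e2 _; lia.
  + by case: e2 => /subsetP + _; apply.
  + have m'k : (m' <= 105 * k)%N by lia.
    have gain : (m' = 105 * k \/ t.+1 * (257 * k + 597) <= a' * b')%N.
      case: E' => [E'|E']; first by left; lia.
      by case: E => [E|E]; [left; lia|right; rewrite mulSn; lia].
    have [tk'|kt'] := ltnP t.+1 (15 * k); first by constructor 1.
    constructor 2; split; try lia.
    case: gain => [->|gain]; first by lia.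
    have [_ ab' _ _] := bL'.
    have s' : (a' + b' <= 120 * k)%N by lia.
    (* At the end of the greedy phase a shortfall of additions contradicts the
       inequality of the arithmetic and geometric means. *)
    have agm := leq_trans (nat_AGM2 a' b') (leq_mul s' s').
    have tE : (t.+1 = 15 * k)%N by lia.
    by rewrite tE in gain; have [] := head_start_bound (_ : 0 < k)%N agm gain; lia.
  + by lia.
- have [L2 [e2 bL2]] := balanced_add2 bL1.
  exists L2, t.+1, m.+2, a1.+1, b1.+1; split=> //.
  + by apply: extends_trans e1 e2 _; lia.
  + by case: e2 => /subsetP + _; apply.
  + have [tk'|kt'] := ltnP t.+1 (55 * k); first by constructor 2; split; lia.
    have [tk''|kt''] := ltnP t.+1 (87 * k); first by constructor 3; split; lia.
    by constructor 4; split; lia.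
  + by lia.
- have [L2 [e2 bL2]] := balanced_add bL1; have [_ _ aK bK] := bL1.
  exists L2, t.+1, m.+1, (a1 + ~~ odd m)%N, (b1 + odd m)%N; split=> //.
  + by apply: extends_trans e1 e2 _; case: ifP; lia.
  + by case: e2 => /subsetP + _; apply.
  + have [tk'|kt'] := ltnP t.+1 (87 * k); first by constructor 3; split; lia.
    by constructor 4; split; lia.
  + by lia.
exists L1, t.+1, m, a1, b1; split=> //.
- by apply: extends_trans e1 (extends_refl L1 0) _; lia.
- by constructor 4; split; lia.
by lia.
Qed.

(** All intervals equal the same point, so they all meet: nothing is directed. *)
Definition blank (n : nat) : layout n :=
  @Layout n (fun=> 0) (fun=> 0) 0 (fun=> lexx 0).

Lemma blank_balanced (n : nat) : balanced 0 0 0 0 (blank n).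
Proof.
have w0 : (price (blank n) 0 <= 0)%N.
  by rewrite leqn0 addn_eq0 !cards_eq0; apply/andP; split; apply/eqP/setP => x;
     rewrite !inE.
have [sA sB] : #|sources (blank n)| = 0%N /\ #|sinks (blank n)| = 0%N.
  by move: w0; rewrite leqn0 addn_eq0 => /andP[/eqP ? /eqP ?].
split=> //; split; rewrite ?sA ?sB //; last by right.
- by move=> x y _ _; exists 0.
- by move=> x y _ _; exists 0.
Qed.

Lemma omaker_loses (n : nat) :
  (0 < n)%N -> ~ omaker_wins n (392 * (n %/ 500) + 600).
Proof.
move=> n0; set k := (n %/ 500)%N; have nk : (n < 500 * k.+1)%N by lia.
pose safe D := exists2 L : layout n, arcs L = D &
  split_small (392 * k + 600) L \/ ~ complete L /\
  exists t m a b, balanced t m a b L /\ on_schedule k t m a b.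
apply: (@obreaker_wins n _ safe).
- exists (blank n); first by apply/setP => x; rewrite !inE.
  right; split; first by move=> /(_ (Ordinal n0)); rewrite !inE.
  exists 0%N, 0%N, 0%N, 0%N; split; first exact: blank_balanced.
  by have [->|k0] := posnP k; [constructor 4|constructor 1; split; lia].
- by move=> _ [L <- _]; apply: arcs_acyclic.
move=> _ e [L <- [sL|[ncL [t [m [a [b [bL sch]]]]]]]] fe.
  have [L' [[sub card] eL' sL']] := split_small_reply sL fe.
  exists (arcs L'); split; rewrite ?subUset ?sub1set ?eL' //.
  by exists L' => //; left.
have [L' [t' [m' [a' [b' [[sub card] eL' bL' sch' small]]]]]] :=
  schedule_step nk ncL bL sch fe.
exists (arcs L'); split; rewrite ?subUset ?sub1set ?eL' //.
exists L' => //; have [cL'|ncL'] := pselect (complete L'); [left|right].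
  by have [[_ _ sa sb _] _ aK bK] := bL'; split=> //; lia.
by split=> //; exists t', m', a', b'.
Qed.

Lemma threshold_lt (n : nat) :
  (0 < n)%N -> (threshold n < 392 * (n %/ 500) + 600)%N.
Proof.
move=> n0; have := omaker_loses n0; set b := (_ + _)%N => lose.
have b0 : (0 < b)%N by rewrite /b; lia.
rewrite ltnNge; apply/negP => bt; exact/lose/(thresholdP n b0).
Qed.

Theorem theorem1p1 (R : realType) :
  exists K : R, forall n : nat, (0 < n)%N ->
    (threshold n)%:R <= 7841 / 10000 * n%:R + K.
Proof.
exists 600%:R => n n0.
have := ltnW (threshold_lt n0); have := leq_trunc_div n 500.
rewrite -!(ler_nat R) natrD !natrM; have : 0 <= n%:R :> R by []; lra.
Qed.
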